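(* If $\mathsf{P}^{dy}=\mathsf{NP}^{dy}$, then $\mathsf{PH}^{dy}=\mathsf{P}^{dy}$.
   Context: Dynamic problems. A dynamic problem is a pair $\mathcal{D}=(\mathcal{P},\mathcal{G})$ where $\mathcal{P}$ maps bit-strings (instances) to answers ($\{0,1\}$ for decision problems) and $\mathcal{G}_n$ is a directed graph on $\{0,1\}^n$ whose edges are allowed instance-updates; $\mathcal{D}_n$ is the restriction to $n$-bit instances; an instance-sequence is a directed path $(I_0,\dots,I_k)$ in $\mathcal{G}_n$. Standing assumption: instance-updates are encodable in $\Theta(\log n)$ bits. The complement of a decision dynamic problem has the same update graphs and negated answers. Bit-probe algorithms. $\mathcal{A}_n$ operates on a bit array; at step $0$ it receives $I_0$ and initializes memory by an arbitrary function of $I_0$ (uncharged); at step $t\ge1$ it receives $(I_{t-1},I_t)$ (possibly with extra input) and runs a fixed decision tree of memory-bit reads (branching) and writes; output is read from a designated region. Update time = tree depth; space = number of memory bits. $\mathcal{A}$ solves decision problem $\mathcal{D}$ if on every instance-sequence of length $\mathrm{poly}(n)$ its output at step $t$ is $\mathcal{D}(I_t)$. $\mathsf{P}^{dy}$: decision problems solvable with update time $O(\mathrm{polylog}\,n)$ and space $O(\mathrm{poly}\,n)$. Verifiers. $\mathcal{V}_n$ gets $I_0$ at step $0$ and outputs $(x_0,y_0)$; at step $t\ge1$ gets $((I_{t-1},I_t),\pi_t)$, $\pi_t\in\{0,1\}^{\mathrm{polylog}\,n}$, outputs $(x_t,y_t)$, $x_t\in\{0,1\}$, $y_t\in\{0,1\}^{\mathrm{polylog}\,n}$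 read as integer reward. A proof-sequence is reward-maximizing if each $\pi_t$ maximizes $y_t$ given the history. $\mathcal{D}\in\mathsf{NP}^{dy}$ iff a verifier-family with update time $O(\mathrm{polylog}\,n)$ and space $O(\mathrm{poly}\,n)$ satisfies: (1) for every proof-sequence, $x_t=0$ whenever $\mathcal{D}(I_t)=0$; (2) for reward-maximizing proof-sequences, $x_t=1$ whenever $\mathcal{D}(I_t)=1$. $\mathsf{coNP}^{dy}$: same with $0$ and $1$ exchanged in both $\mathcal{D}(I_t)$ and $x_t$ (equivalently, complements of $\mathsf{NP}^{dy}$ problems). Oracles. An algorithm/verifier may use an oracle for a dynamic problem $\mathcal{D}'$ on slice $\mathcal{D}'_m$, $m\le\mathrm{BlowUp}(n)$: it feeds an initial instance then instance-updates of $\mathcal{D}'_m$ and reads the answer of the current oracle instance after each call; calls cost no time and oracle memory is not counted. $(\mathcal{C}_1)^{\mathcal{C}_2}$: problems meeting the definition of $\mathcal{C}_1$ when an oracle-family for some problem in $\mathcal{C}_2$ with blow-up $O(\mathrm{poly}\,n)$ may be used. $\Sigma_1=\mathsf{NP}^{dy}$, $\Pi_1=\mathsf{coNP}^{dy}$, $\Sigma_i=(\mathsf{NP}^{dy})^{\Sigma_{i-1}}$, $\Pi_i=(\mathsf{coNP}^{dy})^{\Sigma_{i-1}}$ for $i>1$, and $\mathsf{PH}^{dy}=\bigcup_{i\ge1}(\Sigma_i\cup\Pi_i)$. *)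

(* Defs.v *)
From mathcomp Require Import all_boot.

Set Implicit Arguments.
Unset Strict Implicit.
Unset Printing Implicit Defensive.

(** * Growth rates

   The shifts [n.+1] and [(trunc_log 2 n).+1] only keep the bounds nonzero
   for n <= 1. *)

Definition poly (f : nat -> nat) : Prop :=
  exists c, forall n, f n <= c * n.+1 ^ c.

Definition polylog (f : nat -> nat) : Prop :=
  exists c, forall n, f n <= c * (trunc_log 2 n).+1 ^ c.

Definition theta_log (f : nat -> nat) : Prop :=
  exists c, forall n,
    trunc_log 2 n <= c * f n /\ f n <= c * (trunc_log 2 n).+1.

(** * Dynamic decision problems

   [code I J] is the bit-string by which the update (I, J) is presented to an
   algorithm.  An algorithm follows the instance step by step, so the code only
   has to determine J once I is known; values off the update graph are
   irrelevant. *)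

Notation inst n := (n.-tuple bool).

Record dynproblem := DynProblem {
  answer : forall n, inst n -> bool;
  update : forall n, rel (inst n);
  code_len : nat -> nat;
  code : forall n, inst n -> inst n -> (code_len n).-tuple bool;
  codeP : forall n (I J K : inst n), update I J -> update I K ->
            code I J = code I K -> J = K;
  code_lenP : theta_log code_len
}.

(** [I 0, ..., I k] is an instance-sequence; later values are ignored. *)
Definition inst_seq (D : dynproblem) n k (I : nat -> inst n) : Prop :=
  forall t, t < k -> update D (I t) (I t.+1).

(** * The bit-probe model *)

Definition mem (cell : finType) := {ffun cell -> bool}.

Definition setm (cell : finType) (s : mem cell) (a : cell) (b : bool) :
  mem cell := [ffun c => if c == a then b else s c].

(** [l] lists the addresses of a region of memory. *)
Definition fetch (cell : finType) k (l : 'I_k -> cell) (s : mem cell) :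
  k.-tuple bool := [tuple s (l i) | i < k].

Definition load (cell : finType) k (l : 'I_k -> cell) (u : k.-tuple bool)
    (s : mem cell) : mem cell :=
  [ffun c => if [pick i | l i == c] is Some i then tnth u i else s c].

Inductive dtree (cell : Type) : Type :=
| Stop
| Read of cell & dtree cell & dtree cell
| Write of cell & bool & dtree cell.
Arguments Stop {cell}.

Fixpoint depth (cell : Type) (d : dtree cell) : nat :=
  match d with
  | Stop => 0
  | Read _ d0 d1 => (maxn (depth d0) (depth d1)).+1
  | Write _ _ d' => (depth d').+1
  end.

Fixpoint run (cell : finType) (d : dtree cell) (s : mem cell) : mem cell :=
  match d with
  | Stop => s
  | Read a d0 d1 => if s a then run d1 s else run d0 s
  | Write a b d' => run d' (setm s a b)
  end.

(** The memory array is indexed by the designated cells [port] together with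
   arbitrarily many private cells [work]; all of them count as space. *)
Record machine (n : nat) (port : finType) := Machine {
  work : finType;
  init : inst n -> mem (port + work)%type;
  tree : dtree (port + work)%type
}.

Definition cell n port (M : machine n port) : finType := (port + work M)%type.

Definition time n port (M : machine n port) : nat := depth (tree M).

Definition space n port (M : machine n port) : nat := #|cell M|.

(** What is observable of a machine processing n-bit instances: [a] input bits
   and [b] output bits per step.  [step] is [None] on an illegal oracle
   call, which correct machines are required never to make. *)
Record system (n a b : nat) := System {
  state : Type;
  start : inst n -> state;
  step : a.-tuple bool -> state -> option state;
  output : state -> b.-tuple bool
}.

(** The state after step t, when [w t] is the input of step t >= 1. *)
Fixpoint state_at n a b (S : system n a b) (I0 : inst n)
    (w : nat -> a.-tuple bool) (t : nat) : option (state S) :=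
  if t is t'.+1 then obind (step (w t)) (state_at S I0 w t')
  else Some (start S I0).

Definition io_port (a b : nat) : finType := ('I_a + 'I_b)%type.

Definition system_of n a b (M : machine n (io_port a b)) : system n a b :=
  let inp i : cell M := inl (inl i) in
  let out i : cell M := inl (inr i) in
  {| state := mem (cell M);
     start := @init _ _ M;
     step := fun u s => Some (run (tree M) (load inp u s));
     output := fetch out |}.

(** * Machines with an oracle

   The additional designated cells are those holding the code of an update of
   the oracle instance, the call cell and the answer cell, in this order.
   Writing 1 into the call cell passes the update to the oracle, which puts the
   answer for its new instance into the answer cell.  The call itself is thus
   free, and the number of calls is limited only by the number of writes. *)

Definition oracle_port (q : nat) : finType := ('I_q + unit + unit)%type.

Definition decode (D : dynproblem) m (J : inst m)
    (c : (code_len D m).-tuple bool) : option (inst m) :=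
  [pick K | update D J K && (code D J K == c)].

Section OracleMachine.

Variables (D : dynproblem) (m n a b : nat).

Definition full_port : finType := (io_port a b + oracle_port (code_len D m))%type.

Variables (M : machine n full_port) (init_oracle : inst n -> inst m).

Let inp i : cell M := inl (inl (inl i)).
Let out i : cell M := inl (inl (inr i)).
Let query i : cell M := inl (inr (inl (inl i))).
Let call : cell M := inl (inr (inl (inr tt))).
Let reply : cell M := inl (inr (inr tt)).

Definition oracle_call (c : mem (cell M) * inst m) :
    option (mem (cell M) * inst m) :=
  omap (fun K => (setm c.1 reply (answer D K), K))
       (decode c.2 (fetch query c.1)).

Fixpoint orun (d : dtree (cell M)) (c : mem (cell M) * inst m) :
    option (mem (cell M) * inst m) :=
  match d with
  | Stop => Some c
  | Read x d0 d1 => if c.1 x then orun d1 c else orun d0 c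
  | Write x v d' =>
      let c' := (setm c.1 x v, c.2) in
      if (x == call) && v then obind (orun d') (oracle_call c')
      else orun d' c'
  end.

Definition oracle_system_of : system n a b :=
  {| state := (mem (cell M) * inst m)%type;
     start := fun I0 => let J0 := init_oracle I0 in
                        (setm (init M I0) reply (answer D J0), J0);
     step := fun u c => orun (tree M) (load inp u c.1, c.2);
     output := fun c => fetch out c.1 |}.

End OracleMachine.

(** * Deterministic algorithms *)

Definition solves (D : dynproblem)
    (S : forall n, system n (code_len D n) 1) : Prop :=
  forall l, poly l -> forall n k (I : nat -> inst n),
  k <= l n -> inst_seq D k I ->
  let w t := code D (I t.-1) (I t) in
  forall t, t <= k -> exists2 s,
    state_at (S n) (I 0) w t = Some s & thead (output s) = answer D (I t).

Definition class := dynproblem -> Prop.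

Definition Pdy : class := fun D =>
  exists A : forall n, machine n (io_port (code_len D n) 1),
    [/\ polylog (fun n => time (A n)),
        poly (fun n => space (A n))
      & solves (fun n => system_of (A n))].

(** * Verifiers

   The input is the code of the update followed by the proof; the output is
   the bit x followed by the reward y, in binary. *)

Definition verdict n a r (S : system n a r.+1) (s : state S) : bool :=
  thead (output s).

Definition reward n a r (S : system n a r.+1) (s : state S) : nat :=
  \sum_(i < r) tnth (output s) (lift ord0 i) * 2 ^ i.

Definition vinput (D : dynproblem) n p (I : nat -> inst n)
    (pi : nat -> p.-tuple bool) (t : nat) : (code_len D n + p).-tuple bool :=
  [tuple of code D (I t.-1) (I t) ++ pi t].

(** For every 1 <= t <= k, [pi t] maximizes the reward of step t among all
   proofs, the state after step t - 1 being given. *)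
Definition reward_maximizing (D : dynproblem) n p r
    (S : system n (code_len D n + p) r.+1) (I : nat -> inst n) (k : nat)
    (pi : nat -> p.-tuple bool) : Prop :=
  forall t, t < k -> forall (rho : p.-tuple bool) s s1 s2,
    state_at S (I 0) (vinput D I pi) t = Some s ->
    step (vinput D I pi t.+1) s = Some s1 ->
    step (vinput D I (fun=> rho) t.+1) s = Some s2 ->
    reward s2 <= reward s1.

(** [acc = true] is the condition of NP, [acc = false] that of coNP. *)
Definition verifies (acc : bool) (D : dynproblem) (p r : nat -> nat)
    (S : forall n, system n (code_len D n + p n) (r n).+1) : Prop :=
  forall l, poly l -> forall n k (I : nat -> inst n),
  k <= l n -> inst_seq D k I ->
  forall (pi : nat -> (p n).-tuple bool) t, t <= k -> exists s,
    [/\ state_at (S n) (I 0) (vinput D I pi) t = Some s,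
        answer D (I t) = ~~ acc -> verdict s = ~~ acc
      & reward_maximizing (S n) I k pi ->
        answer D (I t) = acc -> verdict s = acc].

Definition verifiable (acc : bool) : class := fun D =>
  exists (p r : nat -> nat)
         (V : forall n, machine n (io_port (code_len D n + p n) (r n).+1)),
    [/\ polylog p /\ polylog r,
        polylog (fun n => time (V n)),
        poly (fun n => space (V n))
      & verifies acc (fun n => system_of (V n))].

Definition NPdy : class := verifiable true.
Definition coNPdy : class := verifiable false.

(** [m n] is the size of the oracle instances used on n-bit instances. *)
Definition verifiable_with (acc : bool) (C : class) : class := fun D =>
  exists (D' : dynproblem) (m p r : nat -> nat)
         (V : forall n,
            machine n (full_port D' (m n) (code_len D n + p n) (r n).+1))
         (J0 : forall n, inst n -> inst (m n)),
    [/\ C D' /\ poly m,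
        polylog p /\ polylog r,
        polylog (fun n => time (V n)),
        poly (fun n => space (V n))
      & verifies acc (fun n => oracle_system_of (V n) (J0 n))].

Definition NPdy_with : class -> class := verifiable_with true.
Definition coNPdy_with : class -> class := verifiable_with false.

(** * The hierarchy: levels are numbered from 1, and the values at 0 are not
   used. *)

Fixpoint Sigma (i : nat) : class :=
  match i with
  | 0 | 1 => NPdy
  | j.+1 => NPdy_with (Sigma j)
  end.

Definition Pi (i : nat) : class :=
  match i with
  | 0 | 1 => coNPdy
  | j.+1 => coNPdy_with (Sigma j)
  end.

Definition PHdy : class := fun D => exists2 i, 1 <= i & Sigma i D \/ Pi i D.

Definition class_eq (C1 C2 : class) : Prop := forall D, C1 D <-> C2 D.

(* Main.v *)
(** A verifier that calls an oracle for a problem in [Pdy] can run the algorithm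
   for that problem in its own memory, so relativizing [NPdy] or [coNPdy] to
   [Pdy] adds nothing.  Under [Pdy = NPdy] the levels Sigma_i thus collapse to
   [Pdy] one after the other, and each Pi_i collapses to [coNPdy], which is
   contained in [Pdy] because [Pdy] is closed under complement.  The time bounds
   survive since updates of polynomially large oracle instances are still
   encoded in O(log n) bits, and the oracle algorithm is correct on the simulated
   calls because it is correct on instance-sequences of every length. *)

From mathcomp Require Import all_boot.
Require Import Defs.

Set Implicit Arguments.
Unset Strict Implicit.
Unset Printing Implicit Defensive.

(** * Growth rates *)

(* [poly] is [pbounded id] and [polylog] is [pbounded (trunc_log 2)]. *)
Definition pbounded (h f : nat -> nat) : Prop :=
  exists c, forall n, f n <= c * (h n).+1 ^ c.

(** [a + b] serves as both coefficient and exponent, so later proofs may bound the two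
    separately. *)
Lemma pbounded_exp h f a b :
  (forall n, f n <= a * (h n).+1 ^ b) -> pbounded h f.
Proof.
move=> fP; exists (a + b) => n; apply: leq_trans (fP n) _.
by rewrite leq_mul ?leq_addr // leq_pexp2l // leq_addl.
Qed.

Lemma pbounded_const h c : pbounded h (fun=> c).
Proof. by apply: (@pbounded_exp _ _ c 0) => n; rewrite muln1. Qed.

Lemma pbounded_le h f g :
  (forall n, f n <= g n) -> pbounded h g -> pbounded h f.
Proof. by move=> fg [c gP]; exists c => n; apply: leq_trans (fg n) (gP n). Qed.

Lemma pbounded_add h f g :
  pbounded h f -> pbounded h g -> pbounded h (fun n => f n + g n).
Proof.
move=> [c fP] [d gP]; apply: (@pbounded_exp _ _ (c + d) (c + d)) => n.
rewrite mulnDl leq_add //.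
  by apply: leq_trans (fP n) _; rewrite leq_mul // leq_pexp2l // leq_addr.
by apply: leq_trans (gP n) _; rewrite leq_mul // leq_pexp2l // leq_addl.
Qed.

Lemma pbounded_mul h f g :
  pbounded h f -> pbounded h g -> pbounded h (fun n => f n * g n).
Proof.
move=> [c fP] [d gP]; apply: (@pbounded_exp _ _ (c * d) (c + d)) => n.
by rewrite expnD mulnACA leq_mul.
Qed.

Lemma pbounded_comp h h' f m :
  pbounded h f -> pbounded h' (fun n => (h (m n)).+1) ->
  pbounded h' (fun n => f (m n)).
Proof.
move=> [c fP] [d mP].
apply: (@pbounded_exp _ _ (c * d ^ c) (d * c)) => n.
apply: leq_trans (fP _) _; rewrite -mulnA leq_mul // expnM -expnMn.
by have [-> //|c_gt0] := posnP c; rewrite leq_exp2r.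
Qed.

Lemma poly_comp f m : poly f -> poly m -> poly (fun n => f (m n)).
Proof.
move=> fP mP; apply: (@pbounded_comp id id f m fP).
apply: (@pbounded_le _ _ (fun n => m n + 1)) => [n|]; first by rewrite addn1.
by apply: pbounded_add mP _; apply: pbounded_const.
Qed.

(** The logarithm of a polynomial in [n] is O(log n), and a polynomial in that stays
    polylogarithmic. *)
Lemma polylog_comp f m : polylog f -> poly m -> polylog (fun n => f (m n)).
Proof.
move=> fP [c mP]; apply: (@pbounded_comp (trunc_log 2) (trunc_log 2) f m fP).
apply: (@pbounded_exp _ _ (c + c).+1 1) => n; rewrite expn1.
set L := (trunc_log 2 n).+1.
(* Combines [c <= 2 ^ c] with [n.+1 <= 2 ^ L]. *)
have m_le : m n <= 2 ^ (c + L * c).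
  apply: leq_trans (mP n) _; rewrite expnD leq_mul //.
    by rewrite ltnW // ltn_expl.
  rewrite expnM; have [-> //|c_gt0] := posnP c.
  by rewrite leq_exp2r // trunc_log_ltn.
have := leq_trunc_log 2 m_le; rewrite trunc_expnK // => /leq_ltn_trans-> //.
by rewrite -add1n mulSn leq_add // mulnDl [L * c]mulnC leq_add // leq_pmulr.
Qed.

Lemma polylog_code_len D : polylog (code_len D).
Proof.
have [c cP] := code_lenP D; apply: (@pbounded_exp _ _ c 1) => n.
by rewrite expn1; case: (cP n).
Qed.

(** * Simulations between systems *)

(* With [e = true], the simulating system gives the opposite verdicts. *)
Definition simulates (e : bool) n a r (S S' : system n a r.+1) : Prop :=
  exists R : state S -> state S' -> Prop,
    [/\ forall I, R (start S I) (start S' I),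
        forall u c c1 s, R c s -> step u c = Some c1 ->
          exists2 s1, step u s = Some s1 & R c1 s1
      & forall c s, R c s ->
          verdict s = e (+) verdict c /\ reward s = reward c].

(** [e = true] gives the complement and [e = false] keeps the answers, so complementation and oracle
    elimination share one transfer lemma. *)
Definition twist (e : bool) (D : dynproblem) : dynproblem :=
  DynProblem (fun n (I : inst n) => e (+) answer D I) (@codeP D) (code_lenP D).

Section Simulation.

Variables (n a r : nat) (S S' : system n a r.+1).
Variable R : state S -> state S' -> Prop.
Hypotheses (R_start : forall I, R (start S I) (start S' I))
  (R_step : forall u c c1 s, R c s -> step u c = Some c1 ->
     exists2 s1, step u s = Some s1 & R c1 s1).

Lemma state_at_sim I0 w t c : state_at S I0 w t = Some c ->
  exists2 s, state_at S' I0 w t = Some s & R c s.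
Proof.
elim: t c => [|t IHt] c /=; first by case=> <-; exists (start S' I0).
case E: (state_at S I0 w t) => [c0|] //= c0c.
by have [s -> Rs] := IHt _ E; apply: R_step Rs c0c.
Qed.

End Simulation.

(** Matched steps have equal rewards, so proofs that are maximizing for [S'] are maximizing for
    [S]. *)
Lemma verifies_sim e acc D p r
    (S S' : forall n, system n (code_len D n + p n) (r n).+1) :
  (forall n, simulates e (S n) (S' n)) ->
  verifies acc S -> @verifies (e (+) acc) (twist e D) p r S'.
Proof.
move=> SS' SP l lP n k I kl Ik pi t tk.
have [R [R0 R1 Rout]] := SS' n.
have [c [Ec c0 c1]] := SP l lP n k I kl Ik pi t tk.
have [s Es Rs] := state_at_sim R0 R1 Ec.
have [vs _] := Rout _ _ Rs.
exists s; split; first exact: Es.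
- by rewrite vs /= -addbN => /addbI/c0->.
- move=> maxS'; rewrite vs /= => /addbI eqA; congr (_ (+) _); apply: c1 eqA.
  move=> t' t'k rho x x1 x2 Ex Ex1 Ex2.
  have [y Ey Ry] := state_at_sim R0 R1 Ex.
  have [y1 Ey1 /Rout[_ <-]] := R1 _ _ _ _ Ry Ex1.
  have [y2 Ey2 /Rout[_ <-]] := R1 _ _ _ _ Ry Ex2.
  exact: maxS' t' t'k rho y y1 y2 Ey Ey1 Ey2.
Qed.

(** An algorithm is a system with an empty reward ([r = 0]), its output bit being the verdict. *)
Lemma solves_sim e D (S S' : forall n, system n (code_len D n) 1) :
  (forall n, simulates e (S n) (S' n)) ->
  solves S -> @solves (twist e D) S'.
Proof.
move=> SS' SP l lP n k I kl Ik w t tk.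
have [R [R0 R1 Rout]] := SS' n.
have [c Ec ac] := SP l lP n k I kl Ik t tk.
have [s Es Rs] := state_at_sim R0 R1 Ec.
exists s; first exact: Es.
by have [+ _] := Rout _ _ Rs; rewrite /verdict ac.
Qed.

(** * Complementing the verdict

   The cell of the verdict holds the negation of its former content at all
   times, and every access to it is negated accordingly. *)

Section Flip.

Variables (X : finType) (x : X).

Definition flipm (s : mem X) : mem X := [ffun c => (c == x) (+) s c].

Fixpoint flipd (d : dtree X) : dtree X :=
  match d with
  | Stop => Stop
  | Read c d0 d1 =>
      if c == x then Read c (flipd d1) (flipd d0)
      else Read c (flipd d0) (flipd d1)
  | Write c b d' => Write c ((c == x) (+) b) (flipd d')
  end.

Lemma depth_flipd d : depth (flipd d) = depth d.
Proof.
elim: d => [|c d0 IH0 d1 IH1|c b d IHd] //=; last by rewrite IHd.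
by case: eqP => _ /=; rewrite IH0 IH1 // maxnC.
Qed.

Lemma run_flipd d s : run (flipd d) (flipm s) = flipm (run d s).
Proof.
elim: d s => [|c d0 IH0 d1 IH1|c b d IHd] s //=.
  by case: eqP => /= cx; rewrite ffunE; case: eqP => // _; case: (s c) => /=;
    rewrite ?IH0 ?IH1.
rewrite -IHd; congr run; apply/ffunP=> y; rewrite !ffunE.
by case: eqP => // ->.
Qed.

Lemma load_flipm k (l : 'I_k -> X) u s : (forall i, l i != x) ->
  load l u (flipm s) = flipm (load l u s).
Proof.
move=> lx; apply/ffunP=> y; rewrite !ffunE; case: pickP => // i /eqP<-.
by rewrite (negPf (lx i)).
Qed.

End Flip.

Section FlipMachine.

Variables (n a r : nat) (M : machine n (io_port a r.+1)).

Definition flip_machine : machine n (io_port a r.+1) :=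
  let x : cell M := inl (inr ord0) in
  Machine (fun I => flipm x (init M I)) (flipd x (tree M)).

Lemma time_flip_machine : time flip_machine = time M.
Proof. exact: depth_flipd. Qed.

Lemma flip_machine_sim : simulates true (system_of M) (system_of flip_machine).
Proof.
pose x : cell M := inl (inr ord0).
exists (fun c s => s = flipm x c); split=> //.
- move=> u c _ _ -> [<-]; eexists; first by [].
  by rewrite /= load_flipm // run_flipd.
- move=> c _ ->; split.
    by rewrite /verdict /thead /= !tnth_mktuple ffunE eqxx.
  (* Reward bits sit at [lift ord0 i], away from the flipped cell. *)
  by apply: eq_bigr => i _; rewrite /= !tnth_mktuple ffunE.
Qed.

End FlipMachine.

Lemma verifiable_twist acc D :
  verifiable acc D -> verifiable (~~ acc) (twist true D).
Proof.
move=> [p [r [V [pr tV sV VP]]]].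
exists p, r, (fun n => flip_machine (V n)); split=> //.
  by apply: pbounded_le tV => n; rewrite time_flip_machine.
by apply: (verifies_sim (e := true)) VP => n; apply: flip_machine_sim.
Qed.

Lemma Pdy_twist D : Pdy (twist true D) -> Pdy D.
Proof.
move=> [A [tA sA AP]]; exists (fun n => flip_machine (A n)); split=> //.
  by apply: pbounded_le tA => n; rewrite time_flip_machine.
move=> l lP n k I kl Ik w t tk.
(* The flipped machine solves the double complement, whose answers reduce to those of [D] by
   [negbK]. *)
have [s Es sP] := solves_sim (fun n => flip_machine_sim (A n)) AP lP kl Ik tk.
by exists s; [exact: Es | rewrite sP /= negbK].
Qed.

(** * Running an algorithm in place of the oracle *)

Section Embedding.

Variables (X Y : finType).

Definition restrict (f : X -> Y) (s : mem Y) : mem X := [ffun c => s (f c)].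

Fixpoint embed (f : X -> Y) (d : dtree X) (k : dtree Y) : dtree Y :=
  match d with
  | Stop => k
  | Read c d0 d1 => Read (f c) (embed f d0 k) (embed f d1 k)
  | Write c b d' => Write (f c) b (embed f d' k)
  end.

Lemma depth_embed f d k : depth (embed f d k) = depth d + depth k.
Proof.
by elim: d => [|c d0 IH0 d1 IH1|c b d IHd] //=;
  rewrite ?IH0 ?IH1 ?IHd ?addSn ?addn_maxl.
Qed.

Lemma restrict_setm f s a b : injective f ->
  restrict f (setm s (f a) b) = setm (restrict f s) a b.
Proof. by move=> f_inj; apply/ffunP=> c; rewrite !ffunE (inj_eq f_inj). Qed.

Lemma restrict_setm_id f s y b : (forall c, f c != y) ->
  restrict f (setm s y b) = restrict f s.
Proof. by move=> fy; apply/ffunP=> c; rewrite !ffunE (negPf (fy c)). Qed.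

Lemma restrict_load f k (l : 'I_k -> X) u s : injective f ->
  restrict f (load (fun i => f (l i)) u s) = load l u (restrict f s).
Proof.
move=> f_inj; apply/ffunP=> c; rewrite !ffunE.
by under eq_pick => i do rewrite (inj_eq f_inj).
Qed.

Lemma restrict_load_id f k (l : 'I_k -> Y) u s : (forall c i, f c != l i) ->
  restrict f (load l u s) = restrict f s.
Proof.
move=> fl; apply/ffunP=> c; rewrite !ffunE; case: pickP => // i.
by rewrite eq_sym (negPf (fl c i)).
Qed.

End Embedding.

(** All accesses of the embedded tree go through [f], so a disjoint memory [g] survives. *)
Lemma run_embed (X X' Y : finType) (f : X -> Y) (g : X' -> Y) d k s :
  injective f -> (forall c c', g c' != f c) ->
  exists s1, [/\ run (embed f d k) s = run k s1,
    restrict f s1 = run d (restrict f s) & restrict g s1 = restrict g s].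
Proof.
move=> f_inj gf; elim: d s => [|c d0 IH0 d1 IH1|c b d IHd] s /=.
- by exists s.
- by rewrite ffunE; case: (s (f c)).
- have [s1 [-> Ef Eg]] := IHd (setm s (f c) b).
  by exists s1; rewrite Ef Eg restrict_setm // restrict_setm_id.
Qed.

Section Copy.

Variable X : Type.

(** Writes only store constants, so copying must branch; [k] is duplicated, but the depth grows by
    just 2. *)
Definition copy (x y : X) (k : dtree X) : dtree X :=
  Read x (Write y false k) (Write y true k).

Definition copies q (a b : 'I_q -> X) (l : seq 'I_q) (k : dtree X) : dtree X :=
  foldr (fun i => copy (a i) (b i)) k l.

Lemma depth_copies q a b l k :
  depth (@copies q a b l k) = (size l).*2 + depth k.
Proof. by elim: l => //= i l ->; rewrite maxnn doubleS !addSn. Qed.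

End Copy.

Lemma run_copy (X : finType) (x y : X) k s :
  run (copy x y k) s = run k (setm s y (s x)).
Proof. by rewrite /=; case: (s x). Qed.

Lemma run_copies (X : finType) q (a b : 'I_q -> X) k s :
  injective b -> (forall i j, a i != b j) ->
  run (copies a b (enum 'I_q) k) s = run k (load b (fetch a s) s).
Proof.
move=> b_inj ab.
suff [s1 [-> Es Es']] : exists s1,
  [/\ run (copies a b (enum 'I_q) k) s = run k s1,
    forall i, i \in enum 'I_q -> s1 (b i) = s (a i)
  & forall c, (forall i, i \in enum 'I_q -> b i != c) -> s1 c = s c].
  congr run; apply/ffunP=> c; rewrite ffunE; case: pickP => [i /eqP<-|nb].
    by rewrite tnth_mktuple Es ?mem_enum.
  by apply: Es' => i _; rewrite nb.
elim: (enum _) s => [|i l IHl] s; first by exists s.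
rewrite [copies _ _ _ _]/= run_copy.
have [s1 [-> Es Es']] := IHl (setm s (b i) (s (a i))).
exists s1; split=> // [j|c lc].
  (* Sources are never overwritten, as [a] and [b] are disjoint; if [i] is not in [l], injectivity
     of [b] protects [b i] from later writes. *)
  have [jl _|jl] := boolP (j \in l); first by rewrite Es ?ffunE ?(negPf (ab _ _)).
  rewrite inE (negPf jl) orbF => /eqP jE; rewrite {j}jE in jl *.
  rewrite Es' ?ffunE ?eqxx // => j' j'l; apply: contraNneq jl => /b_inj <-.
  exact: j'l.
rewrite Es' ?ffunE.
  by rewrite eq_sym (negPf (lc i _)) // mem_head.
by move=> j jl; apply: lc; rewrite inE jl orbT.
Qed.

(** Inductive because the calls of a verifier extend the oracle's instance-sequence one update at a
    time. *)
Inductive reachable D m (A : machine m (io_port (code_len D m) 1)) :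
    inst m -> mem (cell A) -> Prop :=
| reach_start J : reachable J (init A J)
| reach_step J K s s1 : reachable J s -> update D J K ->
    step (s := system_of A) (code D J K) s = Some s1 -> reachable K s1.
Arguments reachable {D m} A J s.

Lemma state_at_eq n a b (S : system n a b) I0 w w' t :
  (forall u, u <= t -> w u = w' u) -> state_at S I0 w t = state_at S I0 w' t.
Proof.
elim: t => //= t IHt ww'; rewrite ww' // IHt // => u ut.
by rewrite ww' // ltnW.
Qed.

Lemma reachable_seq D m (A : machine m (io_port (code_len D m) 1)) J s :
  reachable A J s -> exists t I, [/\ inst_seq D t I, I t = J
    & state_at (system_of A) (I 0) (fun u => code D (I u.-1) (I u)) t = Some s].
Proof.
elim=> [{}J|{}J K {}s s1 _ [t [I [It <- Es]]] JK Es1].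
  by exists 0, (fun=> J).
exists t.+1, (fun u => if u <= t then I u else K); split; last 2 first.
- by rewrite ltnn.
- have E : state_at (system_of A) (I 0)
      (fun u => code D (if u.-1 <= t then I u.-1 else K)
                       (if u <= t then I u else K)) t = Some s.
    rewrite -Es; apply: state_at_eq => u ut.
    by rewrite ut (leq_trans (leq_pred u) ut).
  by rewrite [LHS]/= E leqnn ltnn.
- move=> u; rewrite ltnS => ut; rewrite ut.
  by move: ut; rewrite leq_eqVlt => /predU1P[->|ut]; rewrite ?ltnn // ut It.
Qed.

Lemma reachable_answer D (A : forall m, machine m (io_port (code_len D m) 1)) m
    (J : inst m) s :
  solves (fun m => system_of (A m)) -> reachable (A m) J s ->
  s (inl (inr ord0)) = answer D J.
Proof.
move=> AP /reachable_seq[t [I [It <- Es]]].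
(* For one given sequence, its own length is an admissible constant bound, so the number of calls
   made does not matter. *)
have lP : poly (fun=> t) by apply: pbounded_const.
have [s' + <-] := AP _ lP m t I (leqnn t) It t (leqnn t).
by rewrite Es => -[<-]; rewrite /thead tnth_mktuple.
Qed.

(** * Simulation of a verifier with an oracle *)

Section OracleElimination.

Variables (D : dynproblem) (m n a b : nat).
Variables (M : machine n (full_port D m a b)) (J0 : inst n -> inst m).
Variable A : machine m (io_port (code_len D m) 1).

Definition sim_work : finType :=
  (oracle_port (code_len D m) + work M + cell A)%type.

Definition sim_cell : finType := (io_port a b + sim_work)%type.

(* The cells of the verifier, the oracle cells becoming private ones. *)
Definition host (c : cell M) : sim_cell :=
  match c with
  | inl (inl p) => inl p
  | inl (inr o) => inr (inl (inl o))
  | inr w => inr (inl (inr w))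
  end.

Definition guest (c : cell A) : sim_cell := inr (inr c).

Lemma host_inj : injective host.
Proof. by move=> [[c|c]|c] [[c'|c']|c'] //= [->]. Qed.

Lemma guest_inj : injective guest.
Proof. by move=> c c' [->]. Qed.

Lemma host_guest c c' : host c != guest c'.
Proof. by case: c => [[c|c]|c]. Qed.

Lemma guest_host c c' : guest c != host c'.
Proof. by rewrite eq_sym host_guest. Qed.

Definition query_cell i : cell M := inl (inr (inl (inl i))).
Definition call_cell : cell M := inl (inr (inl (inr tt))).
Definition reply_cell : cell M := inl (inr (inr tt)).

Definition call_tree (k : dtree sim_cell) : dtree sim_cell :=
  copies (fun i => host (query_cell i)) (fun i => guest (inl (inl i)))
    (enum 'I_(code_len D m))
    (embed guest (tree A) (copy (guest (inl (inr ord0))) (host reply_cell) k)).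

Fixpoint sim_tree (d : dtree (cell M)) : dtree sim_cell :=
  match d with
  | Stop => Stop
  | Read x d0 d1 => Read (host x) (sim_tree d0) (sim_tree d1)
  | Write x v d' =>
      Write (host x) v
        (if (x == call_cell) && v then call_tree (sim_tree d') else sim_tree d')
  end.

Definition sim_init (I : inst n) : mem sim_cell :=
  let s := setm (init M I) reply_cell (answer D (J0 I)) in
  [ffun c : sim_cell => match c with
   | inl p => s (inl (inl p))
   | inr (inl (inl o)) => s (inl (inr o))
   | inr (inl (inr w)) => s (inr w)
   | inr (inr c') => init A (J0 I) c'
   end].

Definition sim_machine : machine n (io_port a b) :=
  @Machine n (io_port a b) sim_work sim_init (sim_tree (tree M)).

Lemma space_sim_machine : space sim_machine = space M + space A.
Proof. by rewrite /space !card_sum !addnA. Qed.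

Lemma time_sim_machine :
  time sim_machine <= time M * ((code_len D m).*2 + time A + 3).
Proof.
(* [B] is the cost of a calling write: the write itself, two per query bit, one run of [A], two for
   the reply. *)
rewrite /time [tree sim_machine]/=; set B := (_ + _ + 3).
elim: (tree M) => [|c d0 IH0 d1 IH1|c v d IHd] //=.
  rewrite mulSn -add1n leq_add //; first by rewrite /B addnS.
  by rewrite maxnMl geq_max !leq_max IH0 IH1 orbT.
rewrite mulSn; case: ifP => _; last by rewrite -add1n leq_add // /B addnS.
rewrite depth_copies depth_embed /= maxnn size_enum_ord.
apply: leq_trans (leq_add (leqnn B) IHd).
by rewrite /B !addnS !addSn addn0 !addnA.
Qed.

(** The current oracle instance is not stored; it is represented only by a state of [A] that can
    arise from it. *)
Definition sim_rel (c : mem (cell M) * inst m) (s : mem sim_cell) : Prop :=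
  restrict host s = c.1 /\ reachable A c.2 (restrict guest s).

Hypothesis AP : forall J s, reachable A J s -> s (inl (inr ord0)) = answer D J.

Lemma run_call_tree c c1 k s : sim_rel c s -> oracle_call c = Some c1 ->
  exists2 s1, run (call_tree k) s = run k s1 & sim_rel c1 s1.
Proof.
case: c => s0 J [/= Es Rs].
rewrite /oracle_call /decode; case: pickP => //= K /andP[JK /eqP cK] [<-].
rewrite /call_tree run_copies; last first.
- by move=> i j; apply: host_guest.
- by move=> i j [].
set u := fetch _ s; set s1 := load _ _ s.
(* Since the call is legal, the query cells hold the code of a genuine update, and [A] makes a legal
   step. *)
have Eu : u = code D J K.
  by rewrite cK; apply: eq_from_tnth => i; rewrite !tnth_mktuple -Es ffunE.
have [s2 [-> Eg Eh]] := run_embed (tree A)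
  (copy (guest (inl (inr ord0))) (host reply_cell) k) s1 guest_inj
  (fun c c' => host_guest c' c).
rewrite run_copy.
have RK : reachable A K (restrict guest s2).
  apply: reach_step Rs JK _; rewrite Eg /=; congr (Some (run _ _)).
  by rewrite -Eu /s1 (restrict_load _ _ _ guest_inj).
eexists; first by [].
split.
  rewrite [RHS]/= restrict_setm; last exact: host_inj.
  rewrite Eh /s1 restrict_load_id; last by move=> c i; apply: host_guest.
  by rewrite Es -(AP RK) ffunE.
by rewrite restrict_setm_id // => c; apply: guest_host.
Qed.

Lemma run_sim_tree d c c1 s : sim_rel c s -> orun d c = Some c1 ->
  sim_rel c1 (run (sim_tree d) s).
Proof.
elim: d c s => [|x d0 IH0 d1 IH1|x v d IHd] c s Rcs.
- by case=> <-.
- rewrite /=; have [<- _] := Rcs; rewrite ffunE.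
  by case: (s (host x)); [apply: IH1|apply: IH0].
have R1 : sim_rel (setm c.1 x v, c.2) (setm s (host x) v).
  have [Es Rs] := Rcs; split; rewrite /=.
    by rewrite restrict_setm ?Es //; apply: host_inj.
  by rewrite restrict_setm_id // => c'; apply: guest_host.
rewrite /=; case: ifP => _; last exact: IHd R1.
case E: oracle_call => [c'|] //= Ec.
by have [s1 -> R1'] := run_call_tree (sim_tree d) R1 E; apply: IHd R1' Ec.
Qed.

End OracleElimination.

Lemma sim_machine_sim D m n a r (M : machine n (full_port D m a r.+1)) J0 A :
  (forall J s, reachable A J s -> s (inl (inr ord0)) = answer D J) ->
  simulates false (oracle_system_of M J0) (system_of (sim_machine M J0 A)).
Proof.
move=> AP; exists (@sim_rel D m n a r.+1 M A); split.
- move=> I; split=> /=.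
    by apply/ffunP=> -[[c|c]|c]; rewrite !ffunE /= !ffunE.
  rewrite (_ : restrict _ _ = init A (J0 I)); first exact: reach_start.
  by apply/ffunP=> c; rewrite !ffunE.
- move=> u c c1 s [Es Rs] Ec; eexists; first by [].
  apply: run_sim_tree Ec => //; split=> /=.
    rewrite -Es; apply: (restrict_load (fun i => inl (inl (inl i)))).
    exact: host_inj.
  by rewrite restrict_load_id.
- move=> c s [Es _].
  have Eo : output (s := oracle_system_of M J0) c
          = output (s := system_of (sim_machine M J0 A)) s.
    by apply: eq_from_tnth => i; rewrite !tnth_mktuple -Es ffunE.
  by rewrite /verdict /reward Eo.
Qed.

(** * Collapse of the hierarchy *)

Lemma verifiable_with_Pdy acc C D : (forall D', C D' -> Pdy D') ->
  verifiable_with acc C D -> verifiable acc D.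
Proof.
move=> CP [D' [m [p [r [V [J0 [[/CP[A [tA sA AP]] mP] prP tV sV VP]]]]]]].
exists p, r, (fun n => sim_machine (V n) (@J0 n) (A (m n))); split=> //.
- apply: (pbounded_le (fun n => time_sim_machine _ _ _)).
  apply: pbounded_mul tV _; apply: pbounded_add (pbounded_const _ 3).
  apply: pbounded_add (polylog_comp tA mP).
  have qP := polylog_comp (polylog_code_len D') mP.
  by apply: pbounded_le (pbounded_add qP qP) => n; rewrite addnn.
- apply: pbounded_le (pbounded_add sV (poly_comp sA mP)) => n.
  by rewrite space_sim_machine.
- (* [verifies] only sees the fields of [twist false D], which compute to those
     of [D] *)
  apply: (verifies_sim (e := false)) VP => n; apply: sim_machine_sim => J s.
  exact: reachable_answer.
Qed.

Theorem mainTheorem3 : class_eq Pdy NPdy -> class_eq PHdy Pdy.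
Proof.
move=> PNP.
have coNP_P D : coNPdy D -> Pdy D.
  (* The complement lies in [NPdy], hence in [Pdy], and complementing again returns to [D]. *)
  by move=> /verifiable_twist/PNP/Pdy_twist.
have Sigma_P i D : Sigma i D -> Pdy D.
  (* Levels 0 and 1 are both [NPdy]; above them the induction hypothesis puts the oracle problem in
     [Pdy]. *)
  elim: i D => [|[|i] IHi] D; [exact: (PNP D).2|exact: (PNP D).2|].
  by move=> /(verifiable_with_Pdy IHi)/PNP.
move=> D; split=> [[i _ [/Sigma_P//|]]|/PNP DNP]; last by exists 1 => //; left.
case: i => [|[|i]]; [exact: coNP_P|exact: coNP_P|].
by move=> /(verifiable_with_Pdy (Sigma_P i.+1))/coNP_P.
Qed.
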